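(* Fix a constant $\delta>0$. There exists $n_0=n_0(\delta)$ such that for any $n\ge n_0$, any $\lambda>0$, any $k\in\{1,\dots,n\}$, any $1\le k'\le n^{1-\delta}$, any $x\in\{0,1\}^n$ with exactly $k$ nonzero entries, any $\beta\ge0$, and any real $\ell$ with $\ell\ge2ek(k'/n)^{1-\delta}$ and $1\le2\ell\le\min\{k,k'\}$, with probability at least $1-2^{-(\ell-2)/2}$ over $W$, $$D_{\beta,\ell}\ \ge\ -\frac{4\beta\lambda}{k}\ell^2+\frac{\log2}{2}\,\ell-\log2 .$$
   Context: $W$ is a $\mathrm{GOE}(n)$ matrix, i.e. an $n\times n$ symmetric random matrix with off-diagonal entries $\mathcal N(0,1/n)$ and diagonal entries $\mathcal N(0,2/n)$, independent up to symmetry, and $Y=\frac{\lambda}{k}xx^\top+W$. Let $S_{k'}=\{v\in\{0,1\}^n:\|v\|_0=k'\}$ and $H(v)=-v^\top Yv$. For $\beta\ge0$ the Gibbs measure on $S_{k'}$ is $\mu_\beta(v)=e^{-\beta H(v)}/\sum_{u\in S_{k'}}e^{-\beta H(u)}$. For $\ell>0$ let $A=\{v\in S_{k'}:0\le\langle v,x\rangle<\ell\}$, $B=\{v\in S_{k'}:\ell\le\langle v,x\rangle\le2\ell\}$, and $D_{\beta,\ell}:=\log\mu_\beta(A)-\log\mu_\beta(B)$ (depth of the free energy well at correlation $\ell$). $\log$ is the natural logarithm and $e$ its base. *)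

(* Defs.v *)
From HB Require Import structures.
From mathcomp Require Import all_boot all_order all_algebra.
From mathcomp Require Import all_classical all_reals all_analysis.

Set Implicit Arguments.
Unset Strict Implicit.
Unset Printing Implicit Defensive.

Import Order.TTheory GRing.Theory Num.Theory.
Import numFieldNormedType.Exports.

Local Open Scope ring_scope.

(* Mutual independence of the family (X i)_{i \in D}: the product rule holds
   for every subfamily and all Borel events. *)
Definition mutually_independent (R : realType) (d : measure_display)
    (T : measurableType d) (P : probability T R) (I : finType) (D : {set I})
    (X : I -> {RV P >-> R}) : Prop :=
  forall (J : {set I}) (E : I -> set R),
    J \subset D -> (forall i, measurable (E i)) ->
    P [set w : T | forall i, i \in J -> E i (X i w)]%classic =
    (\prod_(i in J) P (X i @^-1` E i)%classic)%E.

(* [normal_prob] takes the standard deviation, not the variance, as its second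
   parameter. *)
Definition has_normal_law (R : realType) (d : measure_display)
    (T : measurableType d) (P : probability T R) (X : {RV P >-> R})
    (m var : R) : Prop :=
  forall E : set R, measurable E ->
    distribution P X E = normal_prob m (Num.sqrt var) E.

Record is_GOE (R : realType) (d : measure_display) (T : measurableType d)
    (P : probability T R) (n : nat) (W : 'I_n -> 'I_n -> {RV P >-> R}) : Prop :=
  IsGOE {
    GOE_sym : forall i j w, W i j w = W j i w;
    GOE_off_diag : forall i j, i != j -> has_normal_law (W i j) 0 (1 / n%:R);
    GOE_diag : forall i, has_normal_law (W i i) 0 (2 / n%:R);
    GOE_indep :
      mutually_independent [set p : 'I_n * 'I_n | (p.1 <= p.2)%N]%SET
        (fun p => W p.1 p.2)
  }.

Definition random_mx (R : realType) (d : measure_display)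
    (T : measurableType d) (P : probability T R) (n : nat)
    (W : 'I_n -> 'I_n -> {RV P >-> R}) (w : T) : 'M[R]_n :=
  \matrix_(i, j) W i j w.

(* A vector of {0,1}^n is a Boolean column vector, so that {0,1}^n is a finite
   type; [real_vec] embeds it into R^n. *)
Definition real_vec (R : realType) (n : nat) (v : 'cV[bool]_n) : 'cV[R]_n :=
  map_mx (fun b : bool => b%:R) v.

Definition l0norm (n : nat) (v : 'cV[bool]_n) : nat :=
  #|[set i : 'I_n | v i 0]%SET|.

Definition slice (n k' : nat) : {set 'cV[bool]_n} :=
  [set v : 'cV[bool]_n | l0norm v == k']%SET.

Definition overlap (R : realType) (n : nat) (u v : 'cV[bool]_n) : R :=
  ((real_vec R u)^T *m real_vec R v) 0 0.

Definition spiked_mx (R : realType) (n : nat) (lambda : R) (k : nat)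
    (x : 'cV[bool]_n) (W : 'M[R]_n) : 'M[R]_n :=
  (lambda / k%:R) *: (real_vec R x *m (real_vec R x)^T) + W.

Definition hamiltonian (R : realType) (n : nat) (Y : 'M[R]_n)
    (v : 'cV[bool]_n) : R :=
  - ((real_vec R v)^T *m Y *m real_vec R v) 0 0.

Definition gibbs (R : realType) (n k' : nat) (Y : 'M[R]_n) (beta : R)
    (v : 'cV[bool]_n) : R :=
  expR (- beta * hamiltonian Y v) /
  \sum_(u in slice n k') expR (- beta * hamiltonian Y u).

Definition gibbs_set (R : realType) (n k' : nat) (Y : 'M[R]_n) (beta : R)
    (S : {set 'cV[bool]_n}) : R :=
  \sum_(v in S) gibbs k' Y beta v.

Definition low_overlap (R : realType) (n k' : nat) (x : 'cV[bool]_n) (l : R) :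
    {set 'cV[bool]_n} :=
  [set v in slice n k' | 0 <= overlap R v x < l]%SET.

Definition mid_overlap (R : realType) (n k' : nat) (x : 'cV[bool]_n) (l : R) :
    {set 'cV[bool]_n} :=
  [set v in slice n k' | l <= overlap R v x <= 2 * l]%SET.

(* [ln] is total with [ln r = 0] for [r <= 0], so this is the depth of the well
   only when both sets are nonempty. *)
Definition well_depth (R : realType) (n k' : nat) (Y : 'M[R]_n)
    (x : 'cV[bool]_n) (beta l : R) : R :=
  ln (gibbs_set k' Y beta (low_overlap k' x l)) -
  ln (gibbs_set k' Y beta (mid_overlap k' x l)).

(* Main.v *)
(* Compare with the Gibbs measure of the noise W alone: the spike never lowers a
   weight, and raises it on B by at most a factor exp(4 beta lambda l^2 / k).
   The law of W is invariant under simultaneous permutation of rows and columns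
   and permutations act transitively on the slice, so every v has expected noise
   weight 1 / C(n, k').  Hence the expected noise mass of the complement of A is
   the hypergeometric tail P(<v, x> >= l) <= (e k k' / (n m))^m <= 2^-l with
   m = ceil l.  By Markov, outside an event of probability at most
   2^(-(l-2)/2) this mass is at most 1 / (1 + r) with r = 2^((l-2)/2), so that A
   outweighs its complement, and in particular B, by the factor r.  Large n is
   only needed for B to be nonempty (ln 0 = 0). *)

Require Import Defs.
From HB Require Import structures.
From mathcomp Require Import all_boot all_order all_algebra all_fingroup.
From mathcomp Require Import all_classical all_reals all_analysis.
From mathcomp Require Import measurable_realfun.
From mathcomp Require Import zify ring lra.

Set Implicit Arguments.
Unset Strict Implicit.
Unset Printing Implicit Defensive.

Import Order.TTheory GRing.Theory Num.Theory.
Import numFieldNormedType.Exports.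

Local Open Scope ring_scope.

(** * Supports, and the number of vectors of the slice with large overlap *)

Definition supp (n : nat) (v : 'cV[bool]_n) : {set 'I_n} := [set i | v i 0]%SET.

Lemma overlapE (R : realType) (n : nat) (u v : 'cV[bool]_n) :
  overlap R u v = #|supp u :&: supp v|%:R.
Proof.
rewrite /overlap mxE -sum1_card natr_sum [RHS]big_mkcond /=.
apply: eq_bigr => i _; rewrite !mxE !inE.
by case: (u i 0); case: (v i 0); rewrite /= ?mulr0 ?mulr1.
Qed.

Lemma supp_inj (n : nat) : injective (@supp n).
Proof.
by move=> u v /setP e; apply/colP => i; have := e i; rewrite !inE.
Qed.

Lemma suppK (n : nat) (S : {set 'I_n}) : supp (\col_i (i \in S)) = S.
Proof. by apply/setP => i; rewrite inE mxE. Qed.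

Lemma in_slice (n k : nat) (v : 'cV[bool]_n) : (v \in slice n k) = (#|supp v| == k).
Proof. by rewrite inE. Qed.

Lemma card_slice (n k : nat) : #|slice n k| = 'C(n, k).
Proof.
rewrite -(card_imset _ (@supp_inj n)) -[n in 'C(n, _)]card_ord -card_draws.
apply: eq_card => S; rewrite inE; apply/imsetP/idP => [[v + ->]|hS].
  by rewrite in_slice.
by exists (\col_i (i \in S)); rewrite ?in_slice suppK.
Qed.

(** Removing [M] is injective on supersets of [M] and lands in the subsets of the complement of size
    [k - #|M|]. Equality fails when [k < #|M|]: no superset exists, while truncated subtraction
    makes the bound 1. *)
Lemma card_supersets (T : finType) (M : {set T}) (k : nat) :
  (#|[set B : {set T} | (M \subset B) && (#|B| == k)]|
   <= 'C(#|T| - #|M|, k - #|M|))%N.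
Proof.
have -> : (#|T| - #|M| = #|~: M|)%N by rewrite [in RHS]cardsCs finset.setCK.
rewrite -cards_draws.
have inj : {in [set B : {set T} | (M \subset B) && (#|B| == k)]%SET &,
    injective (fun B => B :\: M)}.
  move=> B C; rewrite !inE => /andP[MB _] /andP[MC _] e.
  by rewrite -(finset.setID B M) -(finset.setID C M) (finset.setIidPr MB) (finset.setIidPr MC) e.
rewrite -(card_in_imset inj); apply/subset_leq_card/fintype.subsetP => A /imsetP[B].
rewrite inE => /andP[MB /eqP <-] ->; rewrite inE cardsDS // eqxx andbT.
by apply/fintype.subsetP => i; rewrite !inE => /andP[].
Qed.

(** The ratio of the two binomials is the product over [i < m] of (k - i)/(n - i), and each factor
    is at most k/n because [k <= n]. Denominators are cleared to stay in [nat]. *)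
Lemma bin_sub_le (n k m : nat) : (m <= k <= n)%N ->
  ('C(n - m, k - m) * n ^ m <= 'C(n, k) * k ^ m)%N.
Proof.
move=> /andP[mk kn]; elim: m mk => [|m IH] mk; first by rewrite !subn0 !muln1.
have {IH} := IH (ltnW mk).
have e := mul_bin_diag (n - m) (k - m).-1.
rewrite prednK ?subn_gt0 // -!subnS in e.
move=> IH.
have nm : (0 < n - m)%N by lia.
rewrite -(leq_pmul2l nm) !expnS.
have h : ((k - m) * n <= k * (n - m))%N by nia.
move: ('C(n - m.+1, k - m.+1)) ('C(n - m, k - m)) e IH => a b e IH.
have -> : ((n - m) * (a * (n * n ^ m)) = ((k - m) * n) * (b * n ^ m))%N.
  by rewrite mulnA e; ring.
apply: leq_trans (leq_mul h IH) _.
by apply: eq_leq; ring.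
Qed.

(** Union bound: a vector counted on the left contains some [m]-subset [M] of the support of [x],
    and each [M] lies in at most ['C(n - m, k - m)] supports of size [k]. *)
Lemma card_large_overlap (n k m : nat) (x : 'cV[bool]_n) : (k <= n)%N ->
  (#|[set v in slice n k | (m <= #|supp v :&: supp x|)%N]| * n ^ m
   <= 'C(#|supp x|, m) * ('C(n, k) * k ^ m))%N.
Proof.
(* For [k < m] no overlap reaches [m], since it is at most the support size [k]. *)
move=> kn; have [mk|km] := leqP m k; last first.
  rewrite (_ : [set v in _ | _]%SET = finset.set0) ?cards0 //.
  apply/setP => v; rewrite !inE; apply/negP => /andP[/eqP vk].
  move=> /leq_trans/(_ (subset_leq_card (finset.subsetIl _ _))).
  by rewrite /supp -/(l0norm v) vk leqNgt km.
pose D := [set M : {set 'I_n} | M \subset supp x & #|M| == m]%SET.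
pose S (M : {set 'I_n}) := [set B : {set 'I_n} | (M \subset B) && (#|B| == k)]%SET.
have le1 : (#|[set v in slice n k | (m <= #|supp v :&: supp x|)%N]%SET|
    <= 'C(#|supp x|, m) * 'C(n - m, k - m))%N.
  rewrite -(card_imset _ (@supp_inj n)).
  apply: (@leq_trans #|\bigcup_(M in D) S M|).
    apply/subset_leq_card/fintype.subsetP => _ /imsetP[v + ->].
    rewrite inE in_slice => /andP[vk mv].
    have : (0 < #|[set M : {set 'I_n} | M \subset supp v :&: supp x & #|M| == m]|)%N.
      by rewrite cards_draws bin_gt0.
    rewrite card_gt0 => /set0Pn[M]; rewrite inE finset.subsetI => /andP[/andP[Mv Mx] Mm].
    by apply/finset.bigcupP; exists M; rewrite inE ?Mx ?Mv.
  have /leq_trans : (#|\bigcup_(M in D) S M| <= \sum_(M in D) #|S M|)%N.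
    elim/big_rec2: _ => [|M a A _ h]; first by rewrite cards0.
    by apply: leq_trans (leq_card_setU _ _) _; rewrite leq_add2l.
  apply; rewrite -cards_draws -sum_nat_const; apply: leq_sum => M.
  rewrite inE => /andP[_ /eqP Mm].
  by have := @card_supersets _ M k; rewrite card_ord Mm.
apply: leq_trans (leq_mul le1 (leqnn _)) _.
by rewrite -mulnA leq_mul2l bin_sub_le ?orbT // mk.
Qed.

(** Induction through (m + 1)^m <= e m^m, that is, (1 + 1/m)^m <= e; the step from 0 to 1 is treated
    apart because of the division by [m]. *)
Lemma expnn_le_fact (R : realType) (m : nat) :
  (m ^ m)%:R <= expR 1 ^+ m * m`!%:R :> R.
Proof.
elim: m => [|m IH]; first by rewrite expn0 expr0 fact0 mulr1.
have [->|m0] := posnP m.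
  by rewrite exp1n factS fact0 muln1 expr1 mulr1; have := @expR_ge1Dx R 1; lra.
have mR : 0 < m%:R :> R by rewrite ltr0n.
have h : m.+1%:R ^+ m <= expR 1 * m%:R ^+ m :> R.
  have -> : m.+1%:R = m%:R * (1 + m%:R^-1) :> R.
    by rewrite mulrDr mulr1 divff ?gt_eqF // natr1.
  rewrite exprMn mulrC ler_wpM2r ?exprn_ge0 ?ler0n //.
  apply: le_trans (_ : expR (m%:R^-1) ^+ m <= _).
    by rewrite lerXn2r ?nnegrE ?expR_ge0 ?addr_ge0 ?invr_ge0 ?ler0n ?expR_ge1Dx.
  by rewrite -expRM_natl mulfV ?gt_eqF.
rewrite natrX exprS factS natrM [expR 1 ^+ _]exprS.
rewrite (_ : _ * _ * _ = m.+1%:R * (expR 1 * (expR 1 ^+ m * m`!%:R))); last by ring.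
rewrite ler_wpM2l ?ler0n //; apply: le_trans h _.
by rewrite ler_wpM2l ?expR_ge0 // -natrX.
Qed.

(** The usual bound of a binomial by (e k / m)^m without division: [m!] times the binomial is the
    falling factorial, a product of [m] factors at most [k]. *)
Lemma bin_mul_expnn_le (R : realType) (k m : nat) :
  'C(k, m)%:R * m%:R ^+ m <= (expR 1 * k%:R) ^+ m :> R.
Proof.
apply: le_trans (_ : 'C(k, m)%:R * (expR 1 ^+ m * m`!%:R) <= _).
  by rewrite ler_wpM2l ?ler0n // -natrX expnn_le_fact.
rewrite mulrCA -natrM bin_ffact exprMn ler_wpM2l ?exprn_ge0 ?expR_ge0 //.
rewrite -natrX ler_nat ffact_prod.
rewrite -[m in (k ^ m)%N]card_ord -prod_nat_const.
by apply: leq_prod => i _; rewrite leq_subr.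
Qed.

Local Open Scope classical_set_scope.

(** * Measurability of the Gibbs weights *)

Lemma measurable_boltzmann (R : realType) (d : measure_display) (T : measurableType d)
    (n : nat) (Y : T -> 'M[R]_n) (beta : R) (v : 'cV[bool]_n) :
  (forall i j, measurable_fun setT (fun t => Y t i j)) ->
  measurable_fun setT (fun t => expR (- beta * hamiltonian (Y t) v)).
Proof.
move=> mY; apply: (@measurableT_comp _ _ _ _ _ _ expR) => //.
apply: measurable_funM; first exact: measurable_cst.
apply: measurable_funN; apply: (eq_measurable_fun (fun t => \sum_j
  (\sum_i real_vec R v i 0 * Y t i j) * real_vec R v j 0)).
  move=> t _; rewrite [RHS]mxE; apply: eq_bigr => j _; congr (_ * _).
  by rewrite [RHS]mxE; apply: eq_bigr => i _; congr (_ * _); rewrite [RHS]mxE.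
apply: measurable_sum => j; apply: measurable_funM; last exact: measurable_cst.
by apply: measurable_sum => i; apply: measurable_funM (measurable_cst _) (mY i j).
Qed.

Lemma sum_expR_gt0 (R : realType) (I : finType) (S : {set I}) (f : I -> R) :
  (0 < #|S|)%N -> 0 < \sum_(u in S) expR (f u).
Proof.
move=> /card_gt0P[u uS]; rewrite (bigD1 u) //= ltr_wpDr ?expR_gt0 //.
by apply: sumr_ge0 => ? _; apply: expR_ge0.
Qed.

Lemma measurable_gibbs (R : realType) (d : measure_display) (T : measurableType d)
    (n k : nat) (Y : T -> 'M[R]_n) (beta : R) (v : 'cV[bool]_n) :
  (k <= n)%N -> (forall i j, measurable_fun setT (fun t => Y t i j)) ->
  measurable_fun setT (fun t => gibbs k (Y t) beta v).
Proof.
move=> kn mY.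
have Z0 t : 0 < \sum_(u in slice n k) expR (- beta * hamiltonian (Y t) u).
  by apply: sum_expR_gt0; rewrite card_slice bin_gt0.
(* The inverse of the partition function [Z] is written exp(- ln Z), valid as [Z > 0], so that
   measurability follows by composing [expR] and [ln]. *)
apply: (eq_measurable_fun (fun t => expR (- beta * hamiltonian (Y t) v) *
  expR (- ln (\sum_(u in slice n k) expR (- beta * hamiltonian (Y t) u))))).
  by move=> t _; rewrite expRN lnK ?posrE.
apply: measurable_funM; first exact: measurable_boltzmann.
apply: (@measurableT_comp _ _ _ _ _ _ expR) => //; apply: measurable_funN.
apply: (@measurableT_comp _ _ _ _ _ _ (@ln R)); first exact: measurable_ln.
apply: (eq_measurable_fun (fun t => \sum_u (if u \in slice n k
  then expR (- beta * hamiltonian (Y t) u) else 0))).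
  by move=> t _; rewrite -big_mkcond.
apply: measurable_sum => u; case: (u \in slice n k); last exact: measurable_cst.
exact: measurable_boltzmann.
Qed.

(** * Joint laws of finitely many real variables *)

(** These sets generate the product Borel sigma-algebra of the coordinates in [D], pulled back to
    functions on all of [I]; coordinates outside [D] are invisible to it. *)
Definition rectangles (R : realType) (I : finType) (D : {set I}) : set (set (I -> R)) :=
  [set A | exists2 E : I -> set R, (forall p, measurable (E p)) &
     A = [set f | forall p, p \in D -> E p (f p)]].
Arguments rectangles R {I} D.

Lemma measurable_coordinate (R : realType) (I : finType) (D : {set I}) (p : I) :
  p \in D -> measurable_fun setT
    ((fun f => f p) : g_sigma_algebraType (rectangles R D) -> R).
Proof.
move=> pD _ B mB; rewrite setTI; apply: sub_sigma_algebra.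
exists (fun q => if q == p then B else setT).
  by move=> q; case: ifP.
apply/seteqP; split=> f /=.
  by move=> Bf q _; case: eqP => // ->.
by move=> /(_ p pD); rewrite eqxx.
Qed.

Lemma measurable_to_rectangles (R : realType) (d : measure_display)
    (T : measurableType d) (I : finType) (D : {set I}) (X : I -> T -> R) :
  (forall p, measurable_fun setT (X p)) ->
  measurable_fun setT
    ((fun w p => X p w) : T -> g_sigma_algebraType (rectangles R D)).
Proof.
move=> mX; apply: (@measurability _ _ T (g_sigma_algebraType (rectangles R D)) setT _
  (rectangles R D)) => // _ [_ [E mE ->] <-].
rewrite setTI.
rewrite (_ : _ @^-1` _ = \bigcap_(p in [set p | p \in D]) (X p @^-1` E p)).
  2: by apply/seteqP; split => w /=.
apply: fin_bigcap_measurable; first exact: finite_finset.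
by move=> p _; rewrite -[_ @^-1` _]setTI; apply: mX.
Qed.

(* The rectangles form a pi-system, so they determine the joint law. *)
Lemma eq_integral_of_rectangles (R : realType) (d : measure_display)
    (T : measurableType d) (P : probability T R) (I : finType) (D : {set I})
    (X X' : I -> T -> R)
    (F : g_sigma_algebraType (rectangles R D) -> R) :
  (forall p, measurable_fun setT (X p)) ->
  (forall p, measurable_fun setT (X' p)) ->
  (forall E : I -> set R, (forall p, measurable (E p)) ->
     P [set w | forall p, p \in D -> E p (X p w)] =
     P [set w | forall p, p \in D -> E p (X' p w)]) ->
  measurable_fun setT F -> (forall f, 0 <= F f) ->
  (\int[P]_w (F (fun p => X p w))%:E = \int[P]_w (F (fun p => X' p w))%:E)%E.
Proof.
move=> mX mX' eqE mF F0.
pose Z := (fun w p => X p w) : T -> g_sigma_algebraType (rectangles R D).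
pose Z' := (fun w p => X' p w) : T -> g_sigma_algebraType (rectangles R D).
pose V : {mfun T >-> g_sigma_algebraType (rectangles R D)} :=
  HB.pack Z (isMeasurableFun.Build _ _ _ _ Z (@measurable_to_rectangles _ _ _ _ D _ mX)).
pose V' : {mfun T >-> g_sigma_algebraType (rectangles R D)} :=
  HB.pack Z' (isMeasurableFun.Build _ _ _ _ Z' (@measurable_to_rectangles _ _ _ _ D _ mX')).
have mFE : measurable_fun setT (EFin \o F) by apply: measurableT_comp.
have FE0 (f : g_sigma_algebraType (rectangles R D)) : (0 <= (EFin \o F) f)%E.
  by rewrite lee_fin.
have := @ge0_integral_distribution _ _ _ _ _ P V _ mFE FE0.
have := @ge0_integral_distribution _ _ _ _ _ P V' _ mFE FE0.
rewrite /= => <- <-.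
apply: eq_measure_integral => A mA _.
apply: (@measure_unique _ R (g_sigma_algebraType (rectangles R D)) (rectangles R D)
  (fun=> setT) _ _ _ _ (distribution P V) (distribution P V')) => //.
- move=> _ _ [E mE ->] [E' mE' ->].
  exists (fun p => E p `&` E' p); first by move=> p; apply: measurableI.
  apply/seteqP; split => f /=.
    by move=> [h h'] p pD; split; [exact: h|exact: h'].
  by move=> h; split => p pD; have [] := h p pD.
- move=> _; exists (fun=> setT) => //.
  by apply/seteqP; split.
- exact: bigcup_const.
- move=> _ [E mE ->]; exact: eqE.
- move=> _; have := @ltry R 1.
  by rewrite -(probability_setT (distribution P V)).
Qed.

(** * Permutation invariance of the law of the GOE entries *)

Definition upper (n : nat) : {set 'I_n * 'I_n} := 
  [set p : 'I_n * 'I_n | (p.1 <= p.2)%N]%SET.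

Definition ordered (n : nat) (i j : 'I_n) : 'I_n * 'I_n :=
  if (i <= j)%N then (i, j) else (j, i).

Lemma orderedC (n : nat) (i j : 'I_n) : ordered i j = ordered j i.
Proof.
by rewrite /ordered; case: (ltngtP i j) => // /val_inj ->.
Qed.

Lemma ordered_upper (n : nat) (i j : 'I_n) : ordered i j \in upper n.
Proof. by rewrite inE /ordered; case: (leqP i j) => //= /ltnW. Qed.

Lemma ordered_id (n : nat) (p : 'I_n * 'I_n) : p \in upper n -> ordered p.1 p.2 = p.
Proof. by rewrite inE /ordered => ->; case: p. Qed.

(** The action of [s] on unordered pairs of indices, read on their representatives on or above the
    diagonal, where the entries are independent. *)
Definition perm_pair (n : nat) (s : {perm 'I_n}) (p : 'I_n * 'I_n) : 'I_n * 'I_n :=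
  ordered (s p.1) (s p.2).

Lemma perm_pairK (n : nat) (s : {perm 'I_n}) :
  {in upper n, cancel (perm_pair s) (perm_pair s^-1)}.
Proof.
move=> p pD; rewrite -[RHS](ordered_id pD) /perm_pair /(ordered (s p.1)).
by case: ifP => _ /=; rewrite !permK // orderedC.
Qed.

Lemma perm_pairVK (n : nat) (s : {perm 'I_n}) :
  {in upper n, cancel (perm_pair s^-1) (perm_pair s)}.
Proof. by move=> p pD; rewrite -{1}[s]invgK perm_pairK. Qed.

(** This is what preserves the variance of an entry: diagonal positions go to diagonal ones and the
    others to off-diagonal ones. *)
Lemma perm_pair_diag (n : nat) (s : {perm 'I_n}) (p : 'I_n * 'I_n) :
  ((perm_pair s p).1 == (perm_pair s p).2) = (p.1 == p.2).
Proof.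
by rewrite /perm_pair /ordered; case: ifP => _ /=; rewrite ?[s p.2 == _]eq_sym (inj_eq perm_inj).
Qed.

Section GOE.
Variables (R : realType) (d : measure_display) (T : measurableType d)
  (P : probability T R) (n : nat) (W : 'I_n -> 'I_n -> {RV P >-> R}).
Hypothesis hW : is_GOE W.

Lemma GOE_ordered (i j : 'I_n) (w : T) :
  W (ordered i j).1 (ordered i j).2 w = W i j w.
Proof. by rewrite /ordered; case: ifP => _ //=; rewrite (GOE_sym hW). Qed.

Lemma GOE_entry_law (i j i' j' : 'I_n) (B : set R) : measurable B ->
  (i == j) = (i' == j') -> P (W i j @^-1` B) = P (W i' j' @^-1` B).
Proof.
move=> mB e; rewrite -[LHS]/(distribution P (W i j) B) -[RHS]/(distribution P (W i' j') B).
have [ij|ij] := eqVneq i j; move: e.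
  rewrite ij eqxx => /esym/eqP ->.
  by rewrite !(GOE_diag hW).
rewrite (negbTE ij) => /esym/negbT ij'.
by rewrite !(GOE_off_diag hW).
Qed.

(** Independence turns both sides into products over [upper n]; reindexing by [perm_pair] matches
    their factors, which have equal laws. *)
Lemma GOE_perm_rectangles (s : {perm 'I_n}) (E : 'I_n * 'I_n -> set R) :
  (forall p, measurable (E p)) ->
  P [set w | forall p, p \in upper n -> E p (W p.1 p.2 w)] =
  P [set w | forall p, p \in upper n -> E p (W (s p.1) (s p.2) w)].
Proof.
move=> mE; pose t := perm_pair s; pose t' := perm_pair s^-1.
(* By symmetry of [W] the permuted entry at [p] is the entry at [t p], which lies in [upper n], so
   the permuted event is again a rectangle in the independent entries. *)
have -> : [set w | forall p, p \in upper n -> E p (W (s p.1) (s p.2) w)] =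
    [set w | forall q, q \in upper n -> E (t' q) (W q.1 q.2 w)].
  apply/seteqP; split => w /= h p pD.
    have := h (t' p) (ordered_upper _ _).
    by rewrite -GOE_ordered -/(perm_pair s (t' p)) /t' (perm_pairVK s pD).
  have := h (t p) (ordered_upper _ _).
  by rewrite /t' /t (perm_pairK s pD) GOE_ordered.
rewrite (GOE_indep hW (fintype.subxx _) mE).
rewrite (GOE_indep hW (fintype.subxx _) (fun q => mE (t' q))).
rewrite (reindex_onto t' t) /=; last by move=> p pD; apply: (perm_pairK s pD).
apply: eq_big => [q|q].
  have [qD|qD] := boolP (q \in upper n).
    by rewrite ordered_upper /t /t' (perm_pairVK s qD) eqxx.
  by apply/negP => /andP[_ /eqP e]; move: qD; rewrite -e ordered_upper.
by move=> _; apply: GOE_entry_law; rewrite // perm_pair_diag.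
Qed.

(** Only the coordinates in [upper n] are read, which makes every entry measurable for the
    sigma-algebra generated by [rectangles R (upper n)]. *)
Definition symmetrize (f : 'I_n * 'I_n -> R) : 'M[R]_n := \matrix_(i, j) f (ordered i j).

Lemma random_mxE (w : T) :
  random_mx W w = symmetrize (fun p => W p.1 p.2 w).
Proof. by apply/matrixP => i j; rewrite !mxE GOE_ordered. Qed.

Lemma perm_random_mxE (s : {perm 'I_n}) (w : T) :
  row_perm s (col_perm s (random_mx W w)) =
  symmetrize (fun p => W (s p.1) (s p.2) w).
Proof.
apply/matrixP => i j; rewrite !mxE /ordered; case: ifP => //= _.
by rewrite (GOE_sym hW).
Qed.

Lemma measurable_random_mx (i j : 'I_n) :
  measurable_fun setT (fun w => random_mx W w i j).
Proof. by apply: (eq_measurable_fun (W i j)) => // w _; rewrite mxE. Qed.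

End GOE.

(** * Permutations acting on the slice and on the Gibbs measure *)

Lemma l0norm_row_perm (n : nat) (s : {perm 'I_n}) (v : 'cV[bool]_n) :
  l0norm (row_perm s v) = l0norm v.
Proof.
rewrite /l0norm -!sum1dep_card [RHS](reindex_inj (@perm_inj _ s)) /=.
by apply: eq_bigl => i; rewrite mxE.
Qed.

(** Two Boolean tuples with equally many [true] entries have equal counts for every predicate, hence
    are permutations of each other. *)
Lemma slice_transitive (n k : nat) (u v : 'cV[bool]_n) :
  u \in slice n k -> v \in slice n k -> exists s : {perm 'I_n}, u = row_perm s v.
Proof.
rewrite !inE => /eqP uk /eqP vk.
have cnt (w : 'cV[bool]_n) (a : pred bool) :
    count a [tuple w i 0 | i < n] = (a true * l0norm w + a false * (n - l0norm w))%N.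
  have -> : (n - l0norm w = #|[set i | ~~ w i 0%R]%SET|)%N.
    rewrite -[n in (n - _)%N]card_ord /l0norm [in LHS]cardsCs.
    rewrite subKn ?max_card //; by apply: eq_card => i; rewrite !inE.
  rewrite /l0norm -!sum1dep_card !big_distrr /= [X in (X + _)%N]big_mkcond.
  rewrite [X in (_ + X)%N]big_mkcond -big_split /=.
  rewrite -sum1_count big_map big_enum_cond /= big_mkcond /=.
  by apply: eq_bigr => i _; case: (w i 0) => /=; rewrite ?muln1 ?addn0.
have /tuple_permP[s e] : perm_eq [tuple u i 0 | i < n] [tuple v i 0 | i < n].
  by apply/seq.permP => a; rewrite !cnt uk vk.
exists s; apply/colP => i; rewrite mxE.
have /(congr1 (fun t => tnth t i)) := val_inj e; by rewrite !tnth_mktuple => ->.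
Qed.

Lemma hamiltonian_row_perm (R : realType) (n : nat) (Y : 'M[R]_n) (s : {perm 'I_n})
    (v : 'cV[bool]_n) :
  hamiltonian Y (row_perm s^-1 v) = hamiltonian (row_perm s (col_perm s Y)) v.
Proof.
rewrite /hamiltonian; congr (- fun_of_matrix _ 0 0).
rewrite /real_vec map_row_perm !row_permE col_permE trmx_mul tr_perm_mx invgK.
by rewrite !mulmxA.
Qed.

(** Moves a permutation from the vector to the matrix; the partition function does not change
    because the slice is stable under permutations. *)
Lemma gibbs_row_perm (R : realType) (n k : nat) (Y : 'M[R]_n) (beta : R)
    (s : {perm 'I_n}) (v : 'cV[bool]_n) :
  gibbs k Y beta (row_perm s^-1 v) = gibbs k (row_perm s (col_perm s Y)) beta v.
Proof.
rewrite /gibbs hamiltonian_row_perm; congr (_ / _).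
have inj : injective (@row_perm bool n 1 s^-1).
  by move=> u w /(congr1 (row_perm s)); rewrite -!row_permM mulgV !row_perm1.
rewrite (reindex_inj inj) /=; apply: eq_big => [u|u _].
  by rewrite !inE l0norm_row_perm.
by rewrite hamiltonian_row_perm.
Qed.

Lemma gibbs_ge0 (R : realType) (n k : nat) (Y : 'M[R]_n) (beta : R) (v : 'cV[bool]_n) :
  0 <= gibbs k Y beta v.
Proof.
by rewrite divr_ge0 ?expR_ge0 // sumr_ge0 // => u _; apply: expR_ge0.
Qed.

Lemma gibbs_set_slice (R : realType) (n k : nat) (Y : 'M[R]_n) (beta : R) :
  (k <= n)%N -> gibbs_set k Y beta (slice n k) = 1.
Proof.
move=> kn; rewrite /gibbs_set -mulr_suml divff // gt_eqF //.
by apply: sum_expR_gt0; rewrite card_slice bin_gt0.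
Qed.

(** * Expected Gibbs mass under pure noise *)

Section GOE_gibbs.
Variables (R : realType) (d : measure_display) (T : measurableType d)
  (P : probability T R) (n k : nat) (W : 'I_n -> 'I_n -> {RV P >-> R}) (beta : R).
Hypotheses (hW : is_GOE W) (kn : (k <= n)%N).

Let measurable_gibbsW v :
  measurable_fun setT (fun w => (gibbs k (random_mx W w) beta v)%:E).
Proof.
by apply/measurable_EFinP/measurable_gibbs => // i j; apply: measurable_random_mx.
Qed.

(** Some permutation carries [v] to [u]; transferred to the noise matrix, it leaves the joint law of
    the entries unchanged. *)
Lemma integral_gibbs_eq (u v : 'cV[bool]_n) :
  u \in slice n k -> v \in slice n k ->
  (\int[P]_w (gibbs k (random_mx W w) beta u)%:E =
   \int[P]_w (gibbs k (random_mx W w) beta v)%:E)%E.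
Proof.
move=> uk vk; have [s ->] := slice_transitive uk vk.
rewrite -[s]invgK.
under eq_integral do rewrite gibbs_row_perm perm_random_mxE //.
under [RHS]eq_integral do rewrite random_mxE //.
pose F : g_sigma_algebraType (rectangles R (upper n)) -> R :=
  fun f => gibbs k (symmetrize f) beta v.
apply/esym.
apply: (@eq_integral_of_rectangles R d T P _ (upper n) (fun p => W p.1 p.2)
  (fun p => W (s^-1 p.1)%g (s^-1 p.2)%g) F) => //.
- exact: GOE_perm_rectangles.
- apply: measurable_gibbs => // i j.
  apply: (eq_measurable_fun ((fun f => f (ordered i j)) :
    g_sigma_algebraType (rectangles R (upper n)) -> R)).
    by move=> f _; rewrite mxE.
  exact: measurable_coordinate (ordered_upper i j).
- by move=> f; apply: gibbs_ge0.
Qed.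

(** All weights on the slice share one expectation [c], and they sum to 1 pointwise, so [c] is the
    inverse of ['C(n, k)]. *)
Lemma integral_gibbs_set (S : {set 'cV[bool]_n}) : S \subset slice n k ->
  (\int[P]_w (gibbs_set k (random_mx W w) beta S)%:E =
   (#|S|%:R / 'C(n, k)%:R)%:E)%E.
Proof.
have intE (S' : {set 'cV[bool]_n}) :
  (\int[P]_w (gibbs_set k (random_mx W w) beta S')%:E =
   \sum_(v in S') \int[P]_w (gibbs k (random_mx W w) beta v)%:E)%E.
  transitivity (\int[P]_w \sum_(v <- enum S') (gibbs k (random_mx W w) beta v)%:E)%E.
    by apply: eq_integral => w _; rewrite sumEFin big_enum.
  rewrite ge0_integral_sum // ?big_enum //.
  by move=> v w _; rewrite lee_fin gibbs_ge0.
move=> /fintype.subsetP Sk; rewrite intE.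
have [v0 v0k] : exists v0, v0 \in slice n k.
  by apply/card_gt0P; rewrite card_slice bin_gt0.
have [c c0 cE] : exists2 c, (0 <= c)%E & forall v, v \in slice n k ->
    (\int[P]_w (gibbs k (random_mx W w) beta v)%:E = c)%E.
  exists (\int[P]_w (gibbs k (random_mx W w) beta v0)%:E)%E.
    by apply: integral_ge0 => w _; rewrite lee_fin gibbs_ge0.
  by move=> v vk; apply: integral_gibbs_eq.
have e : (\sum_(v in slice n k) c = 1)%E.
  transitivity (\int[P]_w (gibbs_set k (random_mx W w) beta (slice n k))%:E)%E.
    by rewrite intE; apply: eq_bigr => v vk; rewrite cE.
  under eq_integral do rewrite gibbs_set_slice //.
  by rewrite integral_cst // mul1e; apply: probability_setT.
transitivity (\sum_(v in S) c)%E.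
  by apply: eq_bigr => v vS; apply: cE; apply: Sk.
have C0 : 'C(n, k)%:R != 0 :> R by rewrite pnatr_eq0 -lt0n bin_gt0.
have CS : ('C(n, k) > 0)%N by rewrite bin_gt0.
move: e; rewrite !sumr_const card_slice.
case: c c0 {cE} => [r| |//] _.
  have EFinMn m : (r%:E *+ m = (r *+ m)%:E)%R.
    by elim: m => // m IH; rewrite !mulrS IH.
  rewrite !EFinMn => -[e]; congr EFin.
  have -> : r = 'C(n, k)%:R^-1 by rewrite -[LHS](mulfK C0) mulr_natr e mul1r.
  by rewrite mulr_natl.
(* An infinite [c] is excluded: a positive multiple of it would be infinite, not 1. *)
case: ('C(n, k)) CS => // N _.
suff -> : +oo%E *+ N.+1 = +oo%E :> \bar R by [].
by elim: N => // N IH; rewrite mulrS IH.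
Qed.
End GOE_gibbs.

(** * Effect of the spike on the well depth *)

Lemma hamiltonian_spiked (R : realType) (n : nat) (lambda : R) (k : nat)
    (x : 'cV[bool]_n) (W : 'M[R]_n) (v : 'cV[bool]_n) :
  hamiltonian (spiked_mx lambda k x W) v =
  hamiltonian W v - lambda / k%:R * overlap R v x ^+ 2.
Proof.
rewrite /hamiltonian /spiked_mx mulmxDr mulmxDl mxE -scalemxAr -scalemxAl mxE.
rewrite opprD addrC; congr (_ - _ * _).
rewrite mulmxA -(mulmxA (_ *m _)) mxE big_ord1 expr2; congr (_ * _).
by rewrite -[real_vec R v in LHS]trmxK -trmx_mul mxE.
Qed.

(* The spike multiplies every noise weight by a factor at least 1, which on
   [mid_overlap] is at most [expR (4 beta lambda l^2 / k)]. *)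
Lemma well_depth_ge (R : realType) (n k k' : nat) (W : 'M[R]_n) (x : 'cV[bool]_n)
    (lambda beta l r : R) :
  0 < lambda -> 0 <= beta -> 0 <= l -> 0 < r -> (k' <= n)%N ->
  mid_overlap k' x l != finset.set0 ->
  gibbs_set k' W beta (slice n k' :\: low_overlap k' x l)%SET * (1 + r) <= 1 ->
  ln r - 4 * beta * lambda / k%:R * l ^+ 2 <=
  well_depth k' (spiked_mx lambda k x W) x beta l.
Proof.
move=> lam0 beta0 l0 r0 kn B0 hC.
set A := low_overlap k' x l in hC *; set B := mid_overlap k' x l in B0.
set C := (_ :\: A)%SET in hC.
pose a (Y : 'M[R]_n) v := expR (- beta * hamiltonian Y v).
pose z Y (S : {set 'cV[bool]_n}) := \sum_(v in S) a Y v.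
set Y := spiked_mx lambda k x W; pose c := 4 * beta * lambda / k%:R * l ^+ 2.
have gE M (S : {set 'cV[bool]_n}) : gibbs_set k' M beta S = z M S / z M (slice n k').
  by rewrite /gibbs_set -mulr_suml.
have Z0 M : 0 < z M (slice n k').
  by apply: sum_expR_gt0; rewrite card_slice bin_gt0.
have aY v : a Y v = a W v * expR (beta * (lambda / k%:R * overlap R v x ^+ 2)).
  by rewrite /a hamiltonian_spiked -expRD; congr expR; ring.
have lamk : 0 <= lambda / k%:R by rewrite divr_ge0 ?ler0n // ltW.
have leA : z W A <= z Y A.
  apply: ler_sum => v _; rewrite aY ler_peMr ?expR_ge0 // -[leLHS]expR0 ler_expR.
  by rewrite mulr_ge0 // mulr_ge0 // sqr_ge0.
have leB : z Y B <= expR c * z W B.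
  rewrite mulr_sumr; apply: ler_sum => v; rewrite inE => /andP[_ /andP[lv v2l]].
  rewrite aY mulrC ler_wpM2r ?expR_ge0 // ler_expR.
  rewrite (_ : c = beta * (lambda / k%:R * (2 * l) ^+ 2)); last by rewrite /c; ring.
  rewrite ler_wpM2l // ler_wpM2l // lerXn2r ?nnegrE //; first exact: le_trans lv.
  by rewrite mulr_ge0.
have leBC : z W B <= z W C.
  rewrite [z W C](big_setID B) /= (finset.setIidPr _) ?lerDl.
    by apply: sumr_ge0 => v _; apply: expR_ge0.
  apply/fintype.subsetP => v; rewrite !inE => /andP[-> /andP[lv _]].
  by rewrite andbT /= negb_and -leNgt lv orbT.
have AC : z W (slice n k') = z W A + z W C.
  rewrite {1}/z (big_setID A) /= (finset.setIidPr _) //.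
  by apply/fintype.subsetP => v; rewrite inE => /andP[].
(* The noise masses of [A] and [C] sum to 1, so mass(C) (1 + r) <= 1 amounts to r mass(C) <=
   mass(A). *)
have leCA : z W C * r <= z W A.
  move: hC; rewrite gE mulrAC ler_pdivrMr // mul1r AC mulrDr mulr1 addrC.
  by rewrite lerD2r.
have ZB0 : 0 < z Y B by apply: sum_expR_gt0; rewrite card_gt0.
have key : z Y B * (r * expR (- c)) <= z Y A.
  apply: le_trans leA; apply: le_trans leCA.
  rewrite mulrCA [X in _ <= X]mulrC ler_wpM2l ?(ltW r0) //.
  by apply: le_trans leBC; rewrite expRN ler_pdivrMr ?expR_gt0 // mulrC.
have ZA0 : 0 < z Y A by apply: lt_le_trans key; rewrite !mulr_gt0 ?expR_gt0.
(* The partition function of [Y] cancels in the difference of logarithms. *)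
rewrite /well_depth !gE -/A -/B !ln_div ?posrE // opprB addrA subrK.
rewrite lerBrDl.
have := key; rewrite -ler_ln ?posrE ?mulr_gt0 ?expR_gt0 //.
by rewrite lnM ?posrE ?mulr_gt0 ?expR_gt0 // lnM ?posrE ?expR_gt0 // expRK.
Qed.

(** * Nonempty middle band, hypergeometric tail and Markov bound *)

(** A member is built from [m] coordinates inside the support of [x] and [k' - m] outside it;
    [k' + #|supp x| <= n] leaves enough room outside. *)
Lemma mid_overlap_neq0 (R : realType) (n k' m : nat) (x : 'cV[bool]_n) (l : R) :
  (m <= #|supp x|)%N -> (m <= k')%N -> (k' + #|supp x| <= n)%N ->
  l <= m%:R -> m%:R <= 2 * l ->
  mid_overlap k' x l != finset.set0.
Proof.
move=> mx mk kx lm m2l.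
have : (0 < #|[set S : {set 'I_n} | S \subset supp x & #|S| == m]%SET|)%N.
  by rewrite cards_draws bin_gt0.
have : (0 < #|[set S : {set 'I_n} | S \subset ~: supp x & #|S| == k' - m]%SET|)%N.
  rewrite cards_draws bin_gt0 [#|~: _|]cardsCs finset.setCK card_ord.
  by lia.
move=> /card_gt0P[S2]; rewrite inE => /andP[S2x /eqP S2m].
move=> /card_gt0P[S1]; rewrite inE => /andP[S1x /eqP S1m].
have dis : S2 :&: supp x = finset.set0.
  apply/setP => i; rewrite !inE; apply/negP => /andP[/(fintype.subsetP S2x)].
  by rewrite !inE => /negbTE ->.
apply/set0Pn; exists (\col_i (i \in S1 :|: S2)).
rewrite inE in_slice overlapE suppK finset.setIUl dis finset.setU0 (finset.setIidPl S1x) S1m lm m2l.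
rewrite cardsU S1m S2m (_ : S1 :&: S2 = finset.set0) ?cards0 ?subn0 ?subnKC ?eqxx //.
apply/eqP; rewrite -finset.subset0 -dis finset.setIC.
by rewrite finset.setIS.
Qed.

(** With [k] the support size of [x], the proportion of such vectors is at most (e k k' / (n m))^m,
    and the hypothesis makes the base at most 1/2. *)
Lemma card_overlap_ge_le (R : realType) (n k' m : nat) (x : 'cV[bool]_n) :
  (0 < m)%N -> (0 < n)%N -> (k' <= n)%N ->
  2 * expR 1 * #|supp x|%:R * (k'%:R / n%:R) <= m%:R :> R ->
  #|[set v in slice n k' | (m <= #|supp v :&: supp x|)%N]%SET|%:R <=
  'C(n, k')%:R / 2 ^+ m :> R.
Proof.
move=> m0 n0 kn h.
have := @card_large_overlap n k' m x kn.
set N := #|_|; set k := #|supp x| in h *.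
rewrite -(ler_nat R) !natrM !natrX => h1.
have h2 := @bin_mul_expnn_le R k m.
have mR : 0 < m%:R :> R by rewrite ltr0n.
have nR : 0 < n%:R :> R by rewrite ltr0n.
have h3 : (2 * (expR 1 * k%:R * k'%:R)) ^+ m <= (m%:R * n%:R) ^+ m :> R.
  apply: lerXn2r; rewrite ?nnegrE ?mulr_ge0 ?expR_ge0 ?ler0n //.
  by move: h; rewrite [_ * (_ / _)]mulrA ler_pdivrMr // !mulrA.
rewrite ler_pdivlMr ?exprn_gt0 //.
(* Both sides are multiplied by (m n)^m, so that the three bounds [h1], [h2], [h3] combine without
   division. *)
rewrite -(ler_pM2r (exprn_gt0 m (mulr_gt0 mR nR))).
apply: le_trans (_ : 'C(n, k')%:R * (2 * (expR 1 * k%:R * k'%:R)) ^+ m <= _); last first.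
  by rewrite ler_wpM2l ?ler0n.
rewrite !exprMn in h2 *.
have C0 : 0 <= 'C(n, k')%:R * k'%:R ^+ m * 2 ^+ m :> R.
  by rewrite !mulr_ge0 ?exprn_ge0 ?ler0n.
have M0 : 0 <= m%:R ^+ m * 2 ^+ m :> R by rewrite mulr_ge0 ?exprn_ge0 ?ler0n.
have h4 := ler_wpM2l C0 h2.
have h5 := ler_wpM2l M0 h1.
move: h4 h5; rewrite -/N.
set a := m%:R ^+ m; set b := n%:R ^+ m; set e := expR 1 ^+ m; set p := 2 ^+ m.
set q := k%:R ^+ m; set q' := k'%:R ^+ m; set u := 'C(n, k')%:R; set w := 'C(k, m)%:R.
by move=> h4 h5; lra.
Qed.

Lemma markov_expectation (R : realType) (d : measure_display) (T : measurableType d)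
    (P : probability T R) (g : T -> R) (N : set T) :
  measurable N -> measurable_fun setT g -> (forall w, 0 <= g w) ->
  (forall w, N w -> 1 <= g w) -> (P N <= \int[P]_w (g w)%:E)%E.
Proof.
move=> mN mg g0 Ng.
rewrite -[N in P N]setIT -integral_indic //.
apply: ge0_le_integral => //.
- exact/measurable_EFinP/measurable_indic.
- exact/measurable_EFinP.
- move=> w _; rewrite lee_fin indicE; case: (boolP (w \in N)) => [/set_mem/Ng//|_].
  exact: g0.
Qed.

Lemma measurable_gibbs_set (R : realType) (d : measure_display) (T : measurableType d)
    (n k : nat) (Y : T -> 'M[R]_n) (beta : R) (S : {set 'cV[bool]_n}) :
  (k <= n)%N -> (forall i j, measurable_fun setT (fun t => Y t i j)) ->
  measurable_fun setT (fun t => gibbs_set k (Y t) beta S).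
Proof.
move=> kn mY; apply: (eq_measurable_fun (fun t => \sum_u (if u \in S
  then gibbs k (Y t) beta u else 0))).
  by move=> t _; rewrite -big_mkcond.
apply: measurable_sum => u; case: (u \in S); last exact: measurable_cst.
exact: measurable_gibbs.
Qed.

(** The witness is the ceiling of [l]. If it is 1, then [1 <= 2 * l] bounds it; if it is at least 2,
    then l > m - 1 >= m/2. *)
Lemma ge_half_ceil (R : realType) (l : R) : 1 <= 2 * l ->
  exists m : nat, [/\ (0 < m)%N, l <= m%:R, m%:R <= 2 * l &
    forall j : nat, l <= j%:R -> (m <= j)%N].
Proof.
move=> hl; have l0 : 0 <= l by lra.
have ex : exists j : nat, l <= j%:R by exists (Num.bound l); rewrite ltW ?archi_boundP.
case: (ex_minnP ex) => m lm mmin; exists m; split => //.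
  by rewrite lt0n; apply/eqP => m0; move: lm; rewrite m0; lra.
case: m lm mmin => [|[|m]] lm mmin; [by lra|by []|].
have : m.+1%:R < l by rewrite ltNge; apply/negP => /mmin; rewrite ltnn.
have : 0 <= m%:R :> R by rewrite ler0n.
by rewrite -!natr1; lra.
Qed.

Lemma measurable_well_depth (R : realType) (d : measure_display)
    (T : measurableType d) (n k' : nat) (Y : T -> 'M[R]_n) (x : 'cV[bool]_n) (beta l : R) :
  (k' <= n)%N -> (forall i j, measurable_fun setT (fun t => Y t i j)) ->
  measurable_fun setT (fun t => well_depth k' (Y t) x beta l).
Proof.
move=> kn mY; apply: measurable_funB;
  apply: (@measurableT_comp _ _ _ _ _ _ (@ln R)) (@measurable_ln R) _;
  exact: measurable_gibbs_set.
Qed.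

(* Choice of parameters and the probability estimate *)
Local Close Scope classical_set_scope.

Theorem theorem3p8 (R : realType) (delta : R) (hdelta : 0 < delta) :
  exists n0 : nat,
    forall (n : nat) (hn : (n0 <= n)%N)
      (lambda : R) (hlambda : 0 < lambda)
      (k : nat) (hk : (1 <= k <= n)%N)
      (k' : nat) (hk' : (1 <= k')%N) (hk'n : k'%:R <= n%:R `^ (1 - delta))
      (x : 'cV[bool]_n) (hx : l0norm x = k)
      (beta : R) (hbeta : 0 <= beta)
      (l : R)
      (hl : 2 * expR 1 * k%:R * (k'%:R / n%:R) `^ (1 - delta) <= l)
      (hl1 : 1 <= 2 * l) (hl2 : 2 * l <= Num.min k%:R k'%:R)
      (d : measure_display) (T : measurableType d) (P : probability T R)
      (W : 'I_n -> 'I_n -> {RV P >-> R}) (hW : is_GOE W),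
      ((1 - 2 `^ (- ((l - 2) / 2)))%:E <=
       P [set w : T |
          (- (4 * beta * lambda / k%:R * l ^+ 2) + ln 2 / 2 * l - ln 2 <=
           well_depth k' (spiked_mx lambda k x (random_mx W w)) x beta l)%R]%classic)%E.
Proof.
(* Chosen so that n^delta >= 2, whence k' <= n^(1 - delta) <= n/2. *)
exists (Num.bound (2 `^ delta^-1 : R)).
move=> n hn lambda hlambda k hk k' hk' hk'n x hx beta hbeta l hl hl1 hl2 d T P W hW.
have [k0 kn] := andP hk.
have n0 : (0 < n)%N by apply: leq_trans kn.
have nR : 0 < n%:R :> R by rewrite ltr0n.
have k'R : 0 < k'%:R :> R by rewrite ltr0n.
have kR : 0 < k%:R :> R by rewrite ltr0n.
have n2 : 2 <= n%:R `^ delta.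
  have h : 2 `^ delta^-1 <= n%:R :> R.
    by apply: ltW; apply: lt_le_trans (archi_boundP (powR_ge0 _ _)) _; rewrite ler_nat.
  have := ge0_ler_powR (ltW hdelta) (powR_ge0 _ _) (ler0n _ _) h.
  by rewrite -powRrM mulVf ?gt_eqF // powRr1.
have k'n2 : 2 * k'%:R <= n%:R :> R.
  have e : n%:R `^ delta * n%:R `^ (1 - delta) = n%:R :> R.
    by rewrite -powRD ?subrKC ?powRr1 ?(gt_eqF nR) ?implybT // addrC subrK powRr1 ?ler0n.
  by rewrite -[leRHS]e; apply: ler_pM => //.
have k'n : (k' <= n)%N by rewrite -(ler_nat R); lra.
have [l2k l2k'] : 2 * l <= k%:R /\ 2 * l <= k'%:R by move: hl2; rewrite le_min => /andP[].
have l0 : 0 < l by lra.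
have y0 : 0 < k'%:R / n%:R :> R by rewrite divr_gt0.
(* As k'/n <= 1, raising the exponent from 1 - delta to 1 only lowers the power; the tail bound
   needs exponent 1. *)
have hy : 2 * expR 1 * k%:R * (k'%:R / n%:R) <= l.
  apply: le_trans hl; rewrite ler_wpM2l ?mulr_ge0 ?expR_ge0 ?ler0n //.
  have y1 : k'%:R / n%:R <= 1 :> R by rewrite ler_pdivrMr // mul1r ler_nat.
  by rewrite -{1}(powRr1 (ltW y0)) ger_powR ?y0 ?y1 //; lra.
(* From 2 e k k' <= l n and 2 l <= k' one gets 4 e k <= n after cancelling k'. With 2 k' <= n this
   yields k + k' <= n, the room needed for a nonempty middle band. *)
have kn4 : 4 * k%:R <= n%:R :> R.
  have e1 : 1 <= expR 1 :> R by rewrite -[leLHS]expR0 ler_expR.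
  have h1 : 2 * expR 1 * k%:R * k'%:R <= l * n%:R.
    by move: hy; rewrite [_ * (_ / _)]mulrA ler_pdivrMr.
  have h2 : k%:R * k'%:R <= expR 1 * (k%:R * k'%:R) :> R by rewrite ler_peMl ?mulr_ge0 ?ler0n.
  have h3 : 2 * l * n%:R <= k'%:R * n%:R by rewrite ler_pM2r.
  by rewrite -(ler_pM2r k'R); lra.
have kk'n : (k' + k <= n)%N by rewrite -(ler_nat R) natrD; lra.
have [m [m0 lm m2l mmin]] := ge_half_ceil hl1.
have hx' : #|supp x| = k by [].
have B0 : mid_overlap k' x l != finset.set0.
  apply: (mid_overlap_neq0 (m := m)) => //; rewrite ?hx' //.
    by rewrite -(ler_nat R) (le_trans m2l).
  by rewrite -(ler_nat R) (le_trans m2l).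
pose C := (slice n k' :\: low_overlap k' x l)%SET.
pose r : R := 2 `^ ((l - 2) / 2).
have r0 : 0 < r by rewrite powR_gt0.
(* An overlap is an integer, so outside the low set it is at least [m], the ceiling of [l]; finally
   2^-m <= 2^-l. *)
have cardC : #|C|%:R / 'C(n, k')%:R <= 2 `^ (- l) :> R.
  have CN : (0 : R) < 'C(n, k')%:R by rewrite ltr0n bin_gt0.
  rewrite ler_pdivrMr //.
  apply: (@le_trans _ _ ('C(n, k')%:R / 2 ^+ m)); last first.
    rewrite mulrC ler_wpM2r ?ler0n // powRN lef_pV2 ?posrE ?powR_gt0 ?exprn_gt0 //.
    by rewrite -powR_mulrn // ler_powR // ler1n.
  apply: le_trans (@card_overlap_ge_le R n k' m x m0 n0 k'n _); last first.
    by rewrite hx'; apply: le_trans lm.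
  rewrite ler_nat; apply/subset_leq_card/fintype.subsetP => v.
  rewrite !inE => /andP[+ vk]; rewrite vk /= overlapE ler0n /= -leNgt => lv.
  exact: mmin.
have depthE : ln 2 / 2 * l - ln 2 = ln r :> R by rewrite ln_powR; lra.
pose Y w := spiked_mx lambda k x (random_mx W w).
pose g w := gibbs_set k' (random_mx W w) beta C * (1 + r).
have mW := @measurable_random_mx R d T P n W.
have mY i j : measurable_fun setT (fun w => Y w i j).
  apply: (eq_measurable_fun (fun w => (lambda / k%:R *: (real_vec R x *m (real_vec R x)^T)) i j
    + random_mx W w i j)) => [w _|]; first by rewrite [RHS]mxE.
  exact: measurable_funD.
set G := [set w | _]%classic.
have mG : measurable G.
  rewrite -[G]setTI; apply: measurable_fun_le => //.
  exact: measurable_well_depth.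
have mg : measurable_fun setT g.
  by apply: measurable_funM => //; apply: measurable_gibbs_set.
have g0 w : 0 <= g w.
  by rewrite mulr_ge0 ?addr_ge0 ?(ltW r0) //; apply: sumr_ge0 => v _; apply: gibbs_ge0.
(* Contrapositive of [well_depth_ge]: where [g w < 1], the depth is at least ln r minus the spike
   term, and [ln r] is the constant of the theorem by [depthE]. *)
have Gg w : (~` G)%classic w -> 1 <= g w.
  move=> nG; rewrite leNgt; apply/negP => /ltW g1; apply: nG; rewrite /G /=.
  rewrite -addrA depthE addrC.
  by apply: well_depth_ge => //; apply: ltW.
have PN := markov_expectation P (measurableC mG) mg g0 Gg.
have intg : (\int[P]_w (g w)%:E = ((1 + r) * (#|C|%:R / 'C(n, k')%:R))%:E)%E.
  rewrite EFinM -(@integral_gibbs_set R d T P n k' W beta hW k'n C (finset.subsetDl _ _)).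
  rewrite -ge0_integralZl_EFin //.
  - by apply: eq_integral => w _; rewrite -EFinM mulrC.
  - by move=> w _; rewrite lee_fin; apply: sumr_ge0 => v _; apply: gibbs_ge0.
  - by apply/measurable_EFinP; apply: measurable_gibbs_set.
  - by rewrite addr_ge0 ?(ltW r0).
have fin : (1 + r) * (#|C|%:R / 'C(n, k')%:R) <= 2 `^ (- ((l - 2) / 2)).
  apply: (@le_trans _ _ ((1 + r) * 2 `^ (- l))).
    by rewrite ler_pM2l // addr_gt0.
  (* In terms of [u], where r u = 1/2 and u <= 1: (1 + r) 2^-l = u^2 + u/2 <= 2 u, and 2 u is the
     allowed failure probability. *)
  pose u : R := 2 `^ (- (l / 2)).
  have u0 : 0 < u by rewrite powR_gt0.
  have u1 : u <= 1.
    by rewrite -[leRHS](powRr0 2) ler_powR ?ler1n //; lra.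
  have e1 : 2 `^ (- l) = u * u.
    rewrite /u -powRD; last by rewrite pnatr_eq0 implybT.
    by congr (2 `^ _); lra.
  have e2 : 2 `^ (- ((l - 2) / 2)) = 2 * u.
    rewrite -[2 in RHS](powRr1 (a := 2)) // /u -powRD; last by rewrite pnatr_eq0 implybT.
    by congr (2 `^ _); lra.
  have e3 : r * u = 2^-1.
    rewrite /u -powRD; last by rewrite pnatr_eq0 implybT.
    by rewrite (_ : _ + _ = -1) ?powR_inv1 //; lra.
  rewrite e1 e2 mulrDl mul1r mulrA e3.
  by nra.
have PG : P G = (1 - P (~` G)%classic)%E.
  by rewrite -probability_setC ?setCK //; apply: measurableC.
rewrite PG EFinB; apply: leeB => //.
by apply: le_trans PN _; rewrite intg lee_fin.
Qed.
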